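(* Let $\mathcal{S}_k=[s_{\min,k},s_{\max,k}]\subset(0,1)$ and let $s_{1,k},s_{2,k}\in(0,1)$ satisfy $$\frac{s_{1,k}+s_{2,k}}2-\frac12<s_{\max,k}<\frac{s_{1,k}+s_{2,k}}2 .$$ Let $u\in H^{s_{2,k}}_\Omega(\mathbb{R}^n)$, $v\in H^{s_{1,k}}_\Omega(\mathbb{R}^n)$, $s\in\mathcal{S}_k$, $\delta\in(0,\infty)$ and $M>2$. Then $$|a'_s(u,v;s,\delta)-\tilde a'_s(u,v;s,\delta)|\le C\,\tilde\eta_k\,\|u\|_{H^{s_{2,k}}_\Omega(\mathbb{R}^n)}\|v\|_{H^{s_{1,k}}_\Omega(\mathbb{R}^n)},\qquad \tilde\eta_k=\tilde\sigma_k^{M}M^2,$$ where $\tilde\sigma_k=(s_{\max,k}-s_{\min,k})/\hat\varepsilon(s_{\max,k})$, $\hat\varepsilon(s)=s_{1,k}+s_{2,k}-2s$, and the constant $C>0$ does not depend on $u$, $v$, $s\in\mathcal{S}_k$ or $M$.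
   Context: $\Omega\subset\mathbb{R}^n$, $n\ge1$, is a bounded domain with $C^\infty$ boundary. $H^t_\Omega(\mathbb{R}^n)=\{v\in H^t(\mathbb{R}^n): v=0\text{ on }\mathbb{R}^n\setminus\Omega\}$ with the seminorm of $H^t(\mathbb{R}^n)$ as norm. The bilinear form is $$a(u,v;s,\delta)=\iint_{\{|x-y|\le\delta\}}\frac{(u(x)-u(y))(v(x)-v(y))}{|x-y|^{n+2s}}\,dy\,dx,$$ and its derivative with respect to $s$ is $$a'_s(u,v;s,\delta)=-2\iint_{\{|x-y|\le\delta\}}\frac{(u(x)-u(y))(v(x)-v(y))\log|x-y|}{|x-y|^{n+2s}}\,dy\,dx .$$ The interpolated derivative is $\tilde a'_s(u,v;s,\delta)=\sum_{m=0}^{M}\Theta'_{\mathcal{S}_k,m}(s)\,a(u,v;s_m,\delta)$ for $s\in\mathcal{S}_k$, where $s_0,\dots,s_M$ are the $M+1$ Chebyshev nodes on $\mathcal{S}_k$ (affine images of the Chebyshev points $\cos(m\pi/M)$, $0\le m\le M$, of $[-1,1]$) and $\Theta_{\mathcal{S}_k,m}$ are the corresponding Lagrange polynomials. *)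

(* Defs.v *)
From HB Require Import structures.
From mathcomp Require Import all_boot all_order all_algebra.
From mathcomp Require Import all_classical all_reals all_analysis.

Set Implicit Arguments.
Unset Strict Implicit.
Unset Printing Implicit Defensive.

Import Order.TTheory GRing.Theory Num.Theory.
Import numFieldNormedType.Exports.

Local Open Scope classical_set_scope.
Local Open Scope ring_scope.

(* The sigma-algebra on 'rV[R]_n generated by the n coordinate maps, i.e. the
   Borel sigma-algebra of R^n. *)
Section measurable_rV.
Context (R : realType) (n : nat).

Let coords : 'I_n -> 'rV[R]_n -> measurableTypeR R := fun i x => x 0 i.

Let rV_set0 : g_sigma_preimage coords set0.
Proof. exact: sigma_algebra0. Qed.

Let rV_setC A : g_sigma_preimage coords A -> g_sigma_preimage coords (~` A).
Proof. exact: sigma_algebraC. Qed.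

Let rV_bigcup (F : _^nat) : (forall i, g_sigma_preimage coords (F i)) ->
  g_sigma_preimage coords (\bigcup_i (F i)).
Proof. exact: sigma_algebra_bigcup. Qed.

Definition rV_display : measure_display.
Proof. exact: default_measure_display. Qed.

HB.instance Definition _ := @isMeasurable.Build rV_display
  'rV[R]_n (g_sigma_preimage coords) rV_set0 rV_setC rV_bigcup.

Lemma measurable_coord (i : 'I_n) :
  measurable_fun [set: 'rV[R]_n] (coords i).
Proof.
move=> _ Y mY; rewrite setTI; apply: sub_sigma_algebra => /=.
rewrite -bigcup_seq/=; exists i => /=; first by rewrite mem_index_enum.
by exists Y => //; rewrite setTI.
Qed.

Lemma measurable_fun_rVP d (T : measurableType d) (f : T -> 'rV[R]_n) :
  (forall i, measurable_fun [set: T] (coords i \o f)) ->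
  measurable_fun [set: T] f.
Proof.
move=> mf _ A mA; rewrite setTI.
suff : g_sigma_preimage (fun i => coords i \o f) `<=` measurable.
  apply; rewrite g_sigma_preimage_comp.
  by exists A => //; rewrite setTI.
apply: smallest_sub; first exact: sigma_algebra_measurable.
rewrite -bigcup_seq; apply: bigcup_sub => i _.
by move=> B [C mC <-]; exact: mf.
Qed.

End measurable_rV.

Section lebesgue_cons.
Context (R : realType) (n : nat).

Definition rV_cons (p : measurableTypeR R * 'rV[R]_n) : 'rV[R]_n.+1 :=
  row_mx (p.1 : R)%:M p.2.

Definition rV_uncons (x : 'rV[R]_n.+1) : measurableTypeR R * 'rV[R]_n :=
  (x 0 0, \row_i x 0 (lift ord0 i)).

Lemma rV_consE0 p : rV_cons p 0 ord0 = p.1.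
Proof.
rewrite /rV_cons (_ : ord0 = lshift n (0 : 'I_1)); last exact/val_inj.
by rewrite (row_mxEl (p.1 : R)%:M p.2) mxE eqxx.
Qed.

Lemma rV_consES p (i : 'I_n) : rV_cons p 0 (lift ord0 i) = p.2 0 i.
Proof.
rewrite /rV_cons (_ : lift ord0 i = rshift 1 i); last exact/val_inj.
by rewrite (row_mxEr (p.1 : R)%:M p.2).
Qed.

Lemma rV_consK : cancel rV_cons rV_uncons.
Proof.
move=> [t x]; congr pair; first exact: rV_consE0.
by apply/rowP => i; rewrite mxE rV_consES.
Qed.

Lemma measurable_rV_cons : measurable_fun setT rV_cons.
Proof.
apply: measurable_fun_rVP => i; case: (unliftP ord0 i) => [j ->|->].
- rewrite (_ : _ \o _ = (fun x : 'rV[R]_n => x 0 j : measurableTypeR R) \o snd).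
    exact: measurableT_comp (measurable_coord j) measurable_snd.
  by apply/funext => p; exact: rV_consES.
- rewrite (_ : _ \o _ = fst); first exact: measurable_fst.
  by apply/funext => p; exact: rV_consE0.
Qed.

Lemma measurable_rV_uncons : measurable_fun setT rV_uncons.
Proof.
apply/measurable_fun_pair; first exact: measurable_coord.
apply: measurable_fun_rVP => i.
rewrite (_ : _ \o _ = fun x : 'rV[R]_n.+1 => x 0 (lift ord0 i)).
  exact: measurable_coord.
by apply/funext => x /=; rewrite mxE.
Qed.

Local Open Scope ereal_scope.
Variable mu : {sigma_finite_measure set 'rV[R]_n -> \bar R}.

(* Image of lebesgue_measure \x mu under R * R^n = R^(n+1). *)
Definition lebesgue_cons (A : set 'rV[R]_n.+1) : \bar R :=
  (@lebesgue_measure R \x mu) (rV_cons @^-1` A).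

Let preim_measurable (A : set 'rV[R]_n.+1) :
  measurable A -> measurable (rV_cons @^-1` A).
Proof. by rewrite -[X in _ -> measurable X]setTI; exact: measurable_rV_cons. Qed.

Let lebesgue_cons0 : lebesgue_cons set0 = 0.
Proof. by rewrite /lebesgue_cons preimage_set0 measure0. Qed.

Let lebesgue_cons_ge0 A : 0 <= lebesgue_cons A.
Proof. exact: measure_ge0. Qed.

Let lebesgue_cons_sigma_additive : semi_sigma_additive lebesgue_cons.
Proof.
move=> F mF tF mUF; rewrite /lebesgue_cons preimage_bigcup.
apply: measure_semi_sigma_additive.
- by move=> k; exact: preim_measurable.
- apply/trivIsetP => /= i j _ _ ij; rewrite -preimage_setI.
  by move/trivIsetP : tF => /(_ _ _ _ _ ij) ->//; rewrite preimage_set0.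
- by rewrite -preimage_bigcup; exact: preim_measurable.
Qed.

HB.instance Definition _ := isMeasure.Build _ _ _ lebesgue_cons
  lebesgue_cons0 lebesgue_cons_ge0 lebesgue_cons_sigma_additive.

Let lebesgue_cons_sigma_finite : sigma_finite setT lebesgue_cons.
Proof.
have /sigma_finiteP[F [TF ndF Foo]] := sigma_finiteT (@lebesgue_measure R).
have /sigma_finiteP[G [TG ndG Goo]] := sigma_finiteT mu.
have UF : \bigcup_k (F k `*` G k) = setT.
  rewrite -setXTT TF TG predeqE => -[x y]; split.
    by move=> [k _ []/= ? ?]; split; exists k.
  move=> [/= [k _ Fkx] [l _ Gly]]; exists (maxn k l) => //; split.
  - by move: x Fkx; exact/subsetPset/ndF/leq_maxl.
  - by move: y Gly; exact/subsetPset/ndG/leq_maxr.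
exists (fun k => rV_uncons @^-1` (F k `*` G k)).
  by rewrite -preimage_bigcup UF preimage_setT.
move=> k; have [mF Fkoo] := Foo k; have [mG Gkoo] := Goo k.
have mFG := measurableX mF mG; split.
  by rewrite -[X in measurable X]setTI; exact: measurable_rV_uncons.
rewrite /lebesgue_cons -comp_preimage (_ : rV_uncons \o rV_cons = id).
  by rewrite preimage_id product_measure1E// lte_mul_pinfty// ge0_fin_numE.
exact/funext/rV_consK.
Qed.

HB.instance Definition _ := @Measure_isSigmaFinite.Build _ _ _
  lebesgue_cons lebesgue_cons_sigma_finite.

End lebesgue_cons.

(* Lebesgue measure on R^n; R^0 is a single point of mass 1. *)
Fixpoint lebesgue_rV (R : realType) (n : nat) :
    {sigma_finite_measure set 'rV[R]_n -> \bar R} :=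
  if n is n'.+1 then lebesgue_cons (lebesgue_rV R n') else dirac (0 : 'rV[R]_0).

Section domain.
Context (R : realType).

Definition enorm n (x : 'rV[R]_n) : R := Num.sqrt (\sum_i x 0 i ^+ 2).

Definition partial n (i : 'I_n) (f : 'rV[R]_n -> R) : 'rV[R]_n -> R :=
  fun x => 'D_(delta_mx 0 i) f x.

Definition iter_partial n (l : seq 'I_n) (f : 'rV[R]_n -> R) :=
  foldr (@partial n) f l.

Definition smooth n (f : 'rV[R]_n -> R) : Prop :=
  forall l : seq 'I_n, continuous (iter_partial l f) /\
    forall (i : 'I_n) x, derivable (iter_partial l f) x (delta_mx 0 i).

(* Near each boundary point, Omega is one side of the graph of a C^oo function
   of n - 1 of the coordinates (col' k x is x without its k-th coordinate). *)
Definition smooth_boundary n (Omega : set 'rV[R]_n) : Prop :=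
  forall x0, (closure Omega `\` Omega°) x0 ->
  exists (r : R) (k : 'I_n) (b : bool) (gamma : 'rV[R]_n.-1 -> R),
    [/\ 0 < r, smooth gamma &
     forall x, enorm (x - x0) < r ->
       Omega x <-> 0 < (-1) ^+ b * (x 0 k - gamma (col' k x))].

Definition smooth_bounded_domain n (Omega : set 'rV[R]_n) : Prop :=
  [/\ Omega !=set0, open Omega, connected Omega, bounded_set Omega &
      smooth_boundary Omega].

End domain.

Section fractional_spaces.
Context (R : realType) (n : nat).
Implicit Types (u v : 'rV[R]_n -> R) (s t delta : R).

Local Notation mu := (lebesgue_rV R n).
Local Notation mu2 := (mu \x mu)%E.

(* Squared Gagliardo seminorm of H^t(R^n), 0 < t < 1. *)
Definition gagliardo2 t u : \bar R :=
  (\int[mu2]_z ((u z.1 - u z.2) ^+ 2 /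
     enorm (z.1 - z.2) `^ (n%:R + 2 * t))%:E)%E.

Definition Hsemi t u : R := Num.sqrt (fine (gagliardo2 t u)).

(* Functions stand for their a.e. classes: v in H^t(R^n) for 0 < t < 1. *)
Definition Hspace t v : Prop :=
  [/\ measurable_fun setT v,
      (\int[mu]_x ((v x ^+ 2)%:E) < +oo)%E &
      (gagliardo2 t v < +oo)%E].

Definition HspaceOmega (Omega : set 'rV[R]_n) t v : Prop :=
  Hspace t v /\ {ae mu, forall x, ~ Omega x -> v x = 0}.

Definition near_diag delta : set ('rV[R]_n * 'rV[R]_n) :=
  [set z | enorm (z.1 - z.2) <= delta].

Definition aform u v s delta : R :=
  \int[mu2]_(z in near_diag delta)
    ((u z.1 - u z.2) * (v z.1 - v z.2) /
       enorm (z.1 - z.2) `^ (n%:R + 2 * s)).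

(* The formal derivative of aform with respect to s. *)
Definition daform u v s delta : R :=
  - 2 * \int[mu2]_(z in near_diag delta)
    ((u z.1 - u z.2) * (v z.1 - v z.2) * ln (enorm (z.1 - z.2)) /
       enorm (z.1 - z.2) `^ (n%:R + 2 * s)).

End fractional_spaces.

Section interpolation.
Context (R : realType).

(* Image in [a, b] of the Chebyshev point cos(m pi / M) of [-1, 1]. *)
Definition cheb_node (a b : R) (M m : nat) : R :=
  (a + b) / 2 + (b - a) / 2 * cos (m%:R * pi / M%:R).

Definition lagrange_cheb (a b : R) (M : nat) (m : 'I_M.+1) : {poly R} :=
  \prod_(j < M.+1 | j != m)
    ((cheb_node a b M m - cheb_node a b M j)^-1 *:
     ('X - (cheb_node a b M j)%:P)).

Definition daform_interp n (u v : 'rV[R]_n -> R) (a b : R) (M : nat)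
    (s delta : R) : R :=
  \sum_(m < M.+1) (lagrange_cheb a b m)^`().[s] *
    aform u v (cheb_node a b M m) delta.

Definition eps_hat (s1 s2 s : R) : R := s1 + s2 - 2 * s.

Definition sigma_tilde (s1 s2 a b : R) : R := (b - a) / eps_hat s1 s2 b.

Definition eta_tilde (s1 s2 a b : R) (M : nat) : R :=
  sigma_tilde s1 s2 a b ^+ M * M%:R ^+ 2.

End interpolation.

(* Main.v *)
Require Import Defs.
From HB Require Import structures.
From mathcomp Require Import all_boot all_order all_algebra.
From mathcomp Require Import all_classical all_reals all_analysis.
From mathcomp Require Import measurable_realfun ring lra.

Import Order.TTheory GRing.Theory Num.Theory.
Import numFieldNormedType.Exports.

Local Open Scope classical_set_scope.
Local Open Scope ring_scope.

Set Implicit Arguments.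
Unset Strict Implicit.
Unset Printing Implicit Defensive.

(** The interpolated derivative differs from the derivative only through the
    kernel.  Write [r = |x - y|] and [t = - ln r]; apart from the factor
    [r ^ (- n)], the kernel of [a(u, v; s)] is [f(s) = expR (2 * t * s)], that
    of its derivative in [s] is [f'(s)], and that of the interpolated derivative
    is the derivative at [s] of the polynomial interpolating [f] at the
    Chebyshev nodes ([daform_interp_Rintegral]).  By Cauchy-Schwarz, a pointwise
    bound of the difference of these kernels by [K * r ^ (- (s1 + s2))], for
    [0 < r <= delta], gives the bound [K * Hsemi s2 u * Hsemi s1 v]
    ([Rintegral_kernel_le]).

    The pointwise bound, with [K = C * sigma ^ M * M ^ 2] and [C] independent
    of [r], [s] and [M], is [interp_kernel_bound].  Interpolation reproduces
    polynomials of degree at most [M], in particular the Taylor polynomial of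
    [f] at the midpoint [c] of [[smin, smax]], so only Taylor remainders matter
    ([lagrange_exp_eq]).  These are tails of the exponential series at arguments
    of size at most [L * |t|], where [L = smax - smin].  The crude tail bound
    [q ^- M * expR (q * L * |t|)] of [expR_tail_le], taken at
    [q = 1 + 1 / sigma], has exactly the growth in [t] that the weight
    [r ^ (- (s1 + s2))] allows, and [q ^- M = (sigma / (1 + sigma)) ^ M] is
    smaller than [sigma ^ M] by the exponential factor [(1 + sigma) ^ M].

    This margin absorbs any polynomial in [M], so the derivatives of the
    Lagrange polynomials need only be bounded polynomially
    ([deriv_lagrange_cheb_le]).  This is where the Chebyshev nodes enter: by
    discrete orthogonality of cosines ([cheb_kernel_node]) the Lagrange
    polynomials are multiples of explicit combinations of Chebyshev polynomials
    [T_k], and [|T_k'| <= k ^ 2] on [[-1, 1]]. *)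

(** * Chebyshev polynomials and discrete orthogonality *)

Section chebyshev.
Context {R : realType}.
Implicit Types (x t : R) (k M : nat).

(** The pair [(T_k, U_(k-1))] of Chebyshev polynomials of the first and second
    kind.  The joint recurrence is the pair of addition formulas for
    [cos ((k + 1) t)] and [sin ((k + 1) t) / sin t]; starting from [U_(-1) = 0]
    makes the derivative formula [T_k' = k U_(k-1)] uniform in [k]. *)
Fixpoint cheb k : {poly R} * {poly R} :=
  if k is k'.+1 then
    let: (c, s) := cheb k' in ('X * c - (1 - 'X^2) * s, 'X * s + c)
  else (1, 0).

Definition chebT k : {poly R} := (cheb k).1.
Definition chebS k : {poly R} := (cheb k).2.

Lemma chebTS k : chebT k.+1 = 'X * chebT k - (1 - 'X^2) * chebS k.
Proof. by rewrite /chebT /chebS /=; case: (cheb k). Qed.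

Lemma chebSS k : chebS k.+1 = 'X * chebS k + chebT k.
Proof. by rewrite /chebT /chebS /=; case: (cheb k). Qed.

Lemma cheb_cos k t :
  (chebT k).[cos t] = cos (k%:R * t) /\
  sin t * (chebS k).[cos t] = sin (k%:R * t).
Proof.
elim: k => [|k [IHT IHS]].
  by rewrite /chebT /chebS /= mul0r cos0 sin0 !hornerE.
have kS : k.+1%:R * t = k%:R * t + t by rewrite -natr1 mulrDl mul1r.
have c2 : 1 - cos t ^+ 2 = sin t ^+ 2 by rewrite -(cos2Dsin2 t); ring.
rewrite chebTS chebSS !hornerE kS cosD sinD -IHT -IHS c2; split; ring.
Qed.

Lemma size_cheb k : (size (chebT k) <= k.+1)%N /\ (size (chebS k) <= k)%N.
Proof.
have szX (p : {poly R}) m : (size p <= m -> size ('X * p)%R <= m.+1)%N.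
  by move=> pm; rewrite (leq_trans (size_polyMleq _ _))// size_polyX add2n.
elim: k => [|k [IHT IHS]].
  by rewrite /chebT /chebS /= size_poly1 size_poly0.
rewrite chebTS chebSS; split; rewrite (leq_trans (size_polyD _ _))// geq_max.
  rewrite szX// size_polyN mulrBl mul1r (leq_trans (size_polyD _ _))// geq_max.
  rewrite size_polyN expr2 -mulrA (szX _ _ (szX _ _ IHS)) andbT.
  by rewrite (leq_trans IHS)// -addn2 leq_addr.
by rewrite szX.
Qed.

(** The second identity is the differential equation of [sin (k t) / sin t]
    with respect to [cos t]; it is what makes the induction for the first one
    close. *)
Lemma deriv_cheb k :
  (chebT k)^`() = k%:R *: chebS k /\
  (1 - 'X^2) * (chebS k)^`() = 'X * chebS k - k%:R *: chebT k.
Proof.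
elim: k => [|k [IHT IHS]].
  by rewrite /chebT /chebS /= !scale0r linear0 !mulr0 subrr derivC.
rewrite chebTS chebSS.
rewrite !derivD !derivN !derivM derivX mul1r IHT.
rewrite -polyC1 derivD derivN derivC derivXn expr1 sub0r.
rewrite -!mul_polyC -natr1 !polyCD !polyC_natr -mulr_natl.
move: IHT IHS; set S' := (chebS k)^`() => IHT IHS.
have := IHS; rewrite -mul_polyC polyC_natr => IHS'.
split; rewrite !polyC1; first by rewrite IHS'; ring.
rewrite [LHS](_ : _ = 'X * ((1 - 'X^2) * S') +
  (1 - 'X^2) * (chebS k + k%:R * chebS k)); last by ring.
by rewrite IHS'; ring.
Qed.

Lemma chebT_le1 k x : -1 <= x <= 1 -> `|(chebT k).[x]| <= 1.
Proof.
move=> xI; have <- : cos (acos x) = x by apply: acosK; rewrite in_itv.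
by rewrite (cheb_cos k _).1 cos_max.
Qed.

Lemma chebS_le k x : -1 <= x <= 1 -> `|(chebS k).[x]| <= k%:R.
Proof.
move=> xI; elim: k => [|k IH]; first by rewrite /chebS /= hornerE normr0.
rewrite chebSS !hornerE -natr1 (le_trans (ler_normD _ _))//.
rewrite lerD ?chebT_le1// normrM -[leRHS]mul1r ler_pM//.
by rewrite ler_norml.
Qed.

Lemma deriv_chebT_le k x : -1 <= x <= 1 -> `|(chebT k)^`().[x]| <= k%:R ^+ 2.
Proof.
move=> xI; rewrite (deriv_cheb k).1 hornerZ normrM normr_nat expr2.
by rewrite ler_wpM2l// chebS_le.
Qed.

Lemma sin_natpi k : sin (k%:R * pi) = 0 :> R.
Proof.
elim: k => [|k IH]; first by rewrite mul0r sin0.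
by rewrite -natr1 mulrDl mul1r sinDpi IH oppr0.
Qed.

(** Trapezoidal sums of [cos (k t)] telescope after multiplication by
    [sin (t / 2)], each term being [cos (t / 2)] times an increment of
    [sin (k t)]. *)
Lemma cos_trapezoid M t : sin (M%:R * t) = 0 -> sin (t / 2) != 0 ->
  \sum_(k < M) (cos (k%:R * t) + cos (k.+1%:R * t)) = 0.
Proof.
move=> sM st; apply: (mulIf st); rewrite mul0r mulr_suml.
transitivity (\sum_(0 <= k < M)
    (cos (t / 2) * sin (k.+1%:R * t) - cos (t / 2) * sin (k%:R * t))).
  rewrite big_mkord; apply: eq_bigr => k _.
  set y := k%:R * t + t / 2.
  have -> : k%:R * t = y - t / 2 by rewrite /y addrK.
  have -> : k.+1%:R * t = y + t / 2.
    by rewrite /y -addn1 natrD; field.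
  by clearbody y; rewrite cosB cosD sinB sinD; ring.
by rewrite telescope_sumr// sM mul0r sin0 subrr.
Qed.

Definition cheb_angle M m : R := m%:R * pi / M%:R.

(** The trapezoidal reproducing kernel
    [\sum_k (T_k(x_m) T_k + T_(k+1)(x_m) T_(k+1))] at the [m]-th Chebyshev
    point [x_m].  It is a multiple of the [m]-th Lagrange polynomial on the
    Chebyshev points, and its derivative is visibly polynomially bounded. *)
Definition cheb_kernel M m : {poly R} :=
  \sum_(k < M) (cos (k%:R * cheb_angle M m) *: chebT k +
                cos (k.+1%:R * cheb_angle M m) *: chebT k.+1).

Lemma size_cheb_kernel M m : (size (cheb_kernel M m) <= M.+1)%N.
Proof.
apply: (leq_trans (size_sum _ _ _)); apply/bigmax_leqP => k _.
rewrite (leq_trans (size_polyD _ _))// geq_max.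
rewrite !(leq_trans (size_scale_leq _ _))//.
- by rewrite (leq_trans (size_cheb _).1)// ltnS.
- by rewrite (leq_trans (size_cheb _).1)// ltnW// ltnS.
Qed.

Lemma cheb_kernelE M m t : (cheb_kernel M m).[cos t] =
  \sum_(k < M) (cos (k%:R * cheb_angle M m) * cos (k%:R * t) +
                cos (k.+1%:R * cheb_angle M m) * cos (k.+1%:R * t)).
Proof.
rewrite horner_sum; apply: eq_bigr => k _.
by rewrite !hornerE !(cheb_cos _ _).1.
Qed.

Lemma sin_half_angle M m j : (0 < M)%N -> (m <= M)%N -> (j < m)%N ->
  sin ((cheb_angle M m - cheb_angle M j) / 2) != 0 /\
  sin ((cheb_angle M m + cheb_angle M j) / 2) != 0.
Proof.
move=> M0 mM jm; have M0' : (0 : R) < M%:R by rewrite ltr0n.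
have mM' : (m%:R : R) <= M%:R by rewrite ler_nat.
have jm' : (j%:R : R) < m%:R by rewrite ltr_nat.
have j0 : (0 : R) <= j%:R by [].
have pi0 := pi_gt0 R.
have key (i : R) : 0 < i < 2 * M%:R -> 0 < i * pi / M%:R / 2 < pi.
  move=> /andP[i0 iM]; rewrite !divr_gt0 ?mulr_gt0//=.
  rewrite ltr_pdivrMr// ltr_pdivrMr//; nra.
split; apply/lt0r_neq0/sin_gt0_pi; rewrite /cheb_angle.
  by rewrite -mulrBl -mulrBl key//; apply/andP; split; lra.
by rewrite -mulrDl -mulrDl key//; apply/andP; split; lra.
Qed.

Lemma sin_mul_angle M m j : (0 < M)%N ->
  sin (M%:R * (cheb_angle M m - cheb_angle M j)) = 0 /\
  sin (M%:R * (cheb_angle M m + cheb_angle M j)) = 0.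
Proof.
move=> M0; have M0' : M%:R != 0 :> R by rewrite pnatr_eq0 -lt0n.
have aE i : M%:R * cheb_angle M i = i%:R * pi.
  by rewrite /cheb_angle mulrCA divff// mulr1.
by rewrite mulrBr mulrDr !aE sinB sinD !sin_natpi !mul0r !mulr0 subrr addr0.
Qed.

(** Discrete orthogonality: by the product formula for cosines the value is the
    sum of two trapezoidal sums, at the difference and at the sum of the two
    Chebyshev angles, and both vanish by [cos_trapezoid]. *)
Lemma cheb_kernel_node M m j : (0 < M)%N -> (m <= M)%N -> (j <= M)%N ->
  j != m -> (cheb_kernel M m).[cos (cheb_angle M j)] = 0.
Proof.
move=> M0 mM jM jm; rewrite cheb_kernelE.
have [sB sD] := sin_mul_angle m j M0.
have [hB hD] : sin ((cheb_angle M m - cheb_angle M j) / 2) != 0 /\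
               sin ((cheb_angle M m + cheb_angle M j) / 2) != 0.
  move: jm; rewrite neq_ltn => /orP[jm|mj]; first exact: sin_half_angle.
  have [hB hD] := sin_half_angle M0 jM mj.
  split; last by rewrite addrC.
  by rewrite -(opprB (cheb_angle M j)) mulNr sinN oppr_eq0.
have tB := cos_trapezoid sB hB; have tD := cos_trapezoid sD hD.
apply: (@mulfI _ 2) => //; rewrite mulr0 -[RHS]addr0.
rewrite -[X in _ = X + _]tB -[X in _ = _ + X]tD.
rewrite mulr_sumr -big_split; apply: eq_bigr => k _ /=.
rewrite !mulrBr !mulrDr !cosB !cosD; ring.
Qed.

(** The value is a sum of squares, one of which is [T_0 (x_m) ^ 2 = 1]. *)
Lemma cheb_kernel_self M m : (0 < M)%N ->
  1 <= (cheb_kernel M m).[cos (cheb_angle M m)].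
Proof.
case: M => // M _; rewrite cheb_kernelE big_ord_recl !mul0r cos0 mulr1.
rewrite -addrA lerDl addr_ge0 -?expr2 ?sqr_ge0// sumr_ge0// => k _.
by rewrite -!expr2 addr_ge0 ?sqr_ge0.
Qed.

Lemma deriv_cheb_kernel_le M m x : -1 <= x <= 1 ->
  `|(cheb_kernel M m)^`().[x]| <= 2 * M%:R ^+ 3.
Proof.
move=> xI; rewrite linear_sum horner_sum (le_trans (ler_norm_sum _ _ _))//.
have -> : 2 * M%:R ^+ 3 = \sum_(k < M) (2 * M%:R ^+ 2) :> R.
  by rewrite sumr_const card_ord -[RHS]mulr_natr; ring.
have T j t : (j <= M)%N -> `|(cos t *: (chebT j)^`()).[x]| <= M%:R ^+ 2.
  move=> jM; rewrite hornerZ normrM -[leRHS]mul1r ler_pM ?cos_max//.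
  by rewrite (le_trans (deriv_chebT_le j xI))// lerXn2r ?nnegrE// ler_nat.
apply: ler_sum => k _; rewrite /= derivD !derivZ hornerD.
by rewrite (le_trans (ler_normD _ _))// [leRHS]mulr_natl mulr2n lerD// T// ltnW.
Qed.

End chebyshev.

(** * Lagrange polynomials on Chebyshev nodes *)

Section interpolation.
Context {R : realType} (a b : R) (M : nat) (ab : a < b) (M0 : (0 < M)%N).
Local Notation node := (cheb_node a b M).
Local Notation L := (lagrange_cheb a b).

Lemma cheb_node_inj (m j : nat) : (m <= M)%N -> (j <= M)%N ->
  node m = node j -> m = j.
Proof.
move=> mM jM /addrI/(mulfI _) E.
have M0' : (0 : R) < M%:R by rewrite ltr0n.
have /cos_inj : cos (cheb_angle M m) = cos (cheb_angle M j) :> R.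
  by apply: E; rewrite mulf_neq0 ?invr_eq0// lt0r_neq0// subr_gt0.
have aI i : (i <= M)%N -> (cheb_angle M i : R) \in `[0, pi].
  move=> iM; have iM' : (i%:R : R) <= M%:R by rewrite ler_nat.
  rewrite in_itv /= /cheb_angle divr_ge0 ?mulr_ge0 ?pi_ge0//=.
  by rewrite ler_pdivrMr// mulrC ler_wpM2l ?pi_ge0.
move=> /(_ (aI _ mM) (aI _ jM)).
move=> /(mulIf (invr_neq0 (lt0r_neq0 M0'))).
move=> /(mulIf (lt0r_neq0 (pi_gt0 R))) /eqP.
by rewrite eqr_nat => /eqP.
Qed.

Lemma size_lagrange_cheb (m : 'I_M.+1) : (size (L m) <= M.+1)%N.
Proof.
rewrite /lagrange_cheb scaler_prod (leq_trans (size_scale_leq _ _))//.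
rewrite (eq_bigl [in predC1 m])// -big_enum size_prod_XsubC -cardE cardC1.
by rewrite card_ord.
Qed.

Lemma lagrange_cheb_node (m j : 'I_M.+1) : (L m).[node j] = (j == m)%:R.
Proof.
rewrite /lagrange_cheb horner_prod; have [->|jm] := eqVneq j m.
  apply: big1 => i im; rewrite hornerZ hornerXsubC mulVf// subr_eq0.
  apply: contra_neq im => E; apply/val_inj.
  by exact/esym/(cheb_node_inj (leq_ord _) (leq_ord _) E).
by rewrite (bigD1 j)//= hornerZ hornerXsubC subrr mulr0 mul0r.
Qed.

Lemma cheb_node_poly_eq (p q : {poly R}) :
  (size p <= M.+1)%N -> (size q <= M.+1)%N ->
  (forall j : 'I_M.+1, p.[node j] = q.[node j]) -> p = q.
Proof.
move=> sp sq pq; apply/eqP; rewrite -subr_eq0; apply/eqP.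
apply: (@roots_geq_poly_eq0 _ _ [seq node (j : 'I_M.+1) | j <- enum 'I_M.+1]).
- apply/allP => _ /mapP[j _ ->].
  by rewrite rootE hornerD hornerN pq subrr.
- rewrite map_inj_uniq ?enum_uniq// => i j E; apply/val_inj.
  exact: cheb_node_inj (leq_ord _) (leq_ord _) E.
- rewrite size_map size_enum_ord (leq_trans (size_polyD _ _))// geq_max sp.
  by rewrite size_polyN.
Qed.

Lemma lagrange_cheb_sum (p : {poly R}) : (size p <= M.+1)%N ->
  p = \sum_(m < M.+1) p.[node m] *: L m.
Proof.
move=> sp; apply: cheb_node_poly_eq => // [|j].
  apply: (leq_trans (size_sum _ _ _)); apply/bigmax_leqP => m _.
  by rewrite (leq_trans (size_scale_leq _ _))// size_lagrange_cheb.
rewrite horner_sum (bigD1 j)//= hornerZ lagrange_cheb_node eqxx mulr1 big1.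
  by rewrite addr0.
by move=> m mj; rewrite hornerZ lagrange_cheb_node eq_sym (negbTE mj) mulr0.
Qed.

(** The increasing affine map of [[a, b]] onto [[-1, 1]]. *)
Definition cheb_affine : {poly R} := (2 / (b - a)) *: ('X - ((a + b) / 2)%:P).

(** Both sides have degree at most [M] and take the same values at the [M + 1]
    nodes: the kernel vanishes at the other Chebyshev points, and
    [cheb_affine] carries the nodes of [[a, b]] to those of [[-1, 1]]. *)
Lemma lagrange_chebE (m : 'I_M.+1) :
  L m = (cheb_kernel M m).[cos (cheb_angle M m)]^-1 *:
        (cheb_kernel M m \Po cheb_affine).
Proof.
set q' := cheb_affine; have ba : b - a != 0.
  by rewrite lt0r_neq0// subr_gt0.
have qn j : q'.[node j] = cos (cheb_angle M j).
  by rewrite hornerZ hornerXsubC /cheb_node /cheb_angle; field.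
apply: cheb_node_poly_eq => [||j].
- exact: size_lagrange_cheb.
- rewrite (leq_trans (size_scale_leq _ _))//.
  rewrite (leq_trans (size_comp_poly_leq _ _))// ltnS.
  have q2 : ((size q').-1 <= 1)%N.
    have : (size q' <= 2)%N.
      by rewrite (leq_trans (size_scale_leq _ _))// size_XsubC.
    by case: size.
  have K2 : ((size (cheb_kernel M m : {poly R})).-1 <= M)%N.
    by have := size_cheb_kernel (R := R) M m; case: size.
  by rewrite (leq_trans (leq_mul K2 q2))// muln1.
- rewrite lagrange_cheb_node hornerZ horner_comp qn.
  have [->|jm] := eqVneq j m.
    by rewrite mulVf// lt0r_neq0// (lt_le_trans ltr01)// cheb_kernel_self.
  by rewrite [X in _ * X]cheb_kernel_node ?mulr0 ?leq_ord.
Qed.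

(** Any bound polynomial in [M] would do: the estimate of the interpolation
    error has an exponential margin, see [interp_kernel_bound]. *)
Lemma deriv_lagrange_cheb_le (m : 'I_M.+1) (s : R) : a <= s <= b ->
  `|(L m)^`().[s]| <= 2 * M%:R ^+ 3 * (2 / (b - a)).
Proof.
move=> /andP[sa sb]; have ba : 0 < b - a by rewrite subr_gt0.
rewrite lagrange_chebE derivZ deriv_comp hornerZ hornerM.
rewrite horner_comp /cheb_affine derivZ derivXsubC.
rewrite !hornerZ hornerXsubC hornerC mulr1.
set y := 2 / (b - a) * _; have yI : -1 <= y <= 1.
  rewrite /y mulrAC; apply/andP; split.
    by rewrite ler_pdivlMr//; lra.
  by rewrite ler_pdivrMr//; lra.
have c0 : 0 <= 2 / (b - a) by rewrite divr_ge0 ?ltW.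
rewrite normrM normrM [X in _ * (_ * X)]ger0_norm// mulrA ler_wpM2r//.
rewrite -[leRHS]mul1r ler_pM ?deriv_cheb_kernel_le//.
rewrite normfV invf_le1 ?(le_trans _ (ler_norm _)) ?(lt_le_trans _ (ler_norm _))//.
  exact: cheb_kernel_self.
by rewrite (lt_le_trans ltr01)// cheb_kernel_self.
Qed.

End interpolation.

(** * Tails of the exponential series *)

Section exponential.
Context {R : realType}.
Implicit Types (q w x z c : R) (k N : nat).

Definition exp_sum N z : R := \sum_(k < N) z ^+ k / k`!%:R.

Lemma exp_sumE N z : exp_sum N z = series (exp_coeff z) N.
Proof. by rewrite /exp_sum /series /= big_mkord. Qed.

Lemma exp_sum_le N z : 0 <= z -> exp_sum N z <= expR z.
Proof.
move=> z0; rewrite exp_sumE; apply: nondecreasing_cvgn_le.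
  apply/nondecreasing_seqP => n; rewrite -subr_ge0 seriesSB.
  by rewrite /exp_coeff /= divr_ge0 ?exprn_ge0.
exact: is_cvg_series_exp_coeff.
Qed.

(** Chernoff's bound for the exponential series: in the tail [N <= k], the
    weight [q ^ k / q ^ N] is at least [1]. *)
Lemma expR_tail_le q z N : 1 <= q ->
  `|expR z - exp_sum N z| <= q ^- N * expR (q * `|z|).
Proof.
move=> q1; have q0 : 0 <= q by exact: le_trans q1.
have qN0 : 0 <= q ^- N by rewrite invr_ge0 exprn_ge0.
have cv : (fun n => `|exp_sum n z - exp_sum N z|) @ \oo -->
    `|expR z - exp_sum N z|.
  apply: cvg_norm; apply: cvgB; last exact: cvg_cst.
  rewrite (_ : exp_sum^~ z = series (exp_coeff z)).
    exact: is_cvg_series_exp_coeff.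
  by apply/funext => n; exact: exp_sumE.
apply: (cvgr_to_le cv); near=> n; have Nn : (N <= n)%N by near: n; exists N.
rewrite (le_trans _ (_ : q ^- N * exp_sum n (q * `|z|) <= _))//; last first.
  by rewrite ler_wpM2l// exp_sum_le// mulr_ge0.
have E i x : exp_sum i x = \sum_(0 <= k < i) x ^+ k / k`!%:R.
  by rewrite big_mkord.
rewrite !{}E.
rewrite (big_cat_nat (n := N))//= addrAC subrr add0r.
rewrite (le_trans (ler_norm_sum _ _ _))// [in leRHS](big_cat_nat (n := N))//=.
rewrite mulrDr -[leLHS]add0r lerD//.
  rewrite mulr_ge0// sumr_ge0// => k _.
  by rewrite divr_ge0// exprn_ge0// mulr_ge0.
rewrite mulr_sumr big_nat [leRHS]big_nat; apply: ler_sum => k /andP[Nk _].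
rewrite normrM normrX normfV normr_nat mulrA ler_wpM2r ?invr_ge0//.
rewrite exprMn mulrA ler_peMl ?exprn_ge0//.
rewrite -(subnK Nk) exprD mulrCA mulVf ?mulr1 ?exprn_ege1//.
by rewrite lt0r_neq0 ?exprn_gt0// (lt_le_trans ltr01).
Unshelve. all: by end_near.
Qed.

(** The Taylor polynomial at [c] of [x |-> expR (w * (x - c))]. *)
Definition exp_taylor c w N : {poly R} :=
  \sum_(k < N) (w ^+ k / k`!%:R) *: ('X - c%:P) ^+ k.

Lemma size_exp_taylor c w N : (size (exp_taylor c w N) <= N)%N.
Proof.
apply: (leq_trans (size_sum _ _ _)); apply/bigmax_leqP => k _.
by rewrite (leq_trans (size_scale_leq _ _))// size_exp_XsubC.
Qed.

Lemma exp_taylorE c w N x :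
  (exp_taylor c w N).[x] = exp_sum N (w * (x - c)).
Proof.
rewrite /exp_taylor /exp_sum horner_sum; apply: eq_bigr => k _.
by rewrite hornerZ horner_exp hornerXsubC exprMn mulrAC.
Qed.

Lemma deriv_exp_taylor c w N :
  (exp_taylor c w N.+1)^`() = w *: exp_taylor c w N.
Proof.
rewrite /exp_taylor big_ord_recl /= expr0 linearD /= derivZ derivC scaler0 add0r.
rewrite linear_sum scaler_sumr; apply: eq_bigr => k _.
rewrite /= /bump add1n derivZ deriv_exp derivXsubC mul1r /=.
rewrite -[_ *+ k.+1]scaler_nat !scalerA.
have k1 : k.+1%:R != 0 :> R by rewrite pnatr_eq0.
congr (_ *: _); rewrite factS natrM exprS.
have k2 : k`!%:R != 0 :> R by rewrite pnatr_eq0 -lt0n fact_gt0.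
by move: (k.+1%:R) k`!%:R k1 k2 => y f y0 f0; field; rewrite y0 f0.
Qed.

End exponential.

(** * Derivative of the interpolation error of an exponential *)

Section kernel.
Context {R : realType}.
Implicit Types (a b eps T s t y : R) (M : nat).

(** [(1 + y) ^ M = expR (M * ln (1 + y))] dominates the quadratic term of the
    exponential series. *)
Lemma sqrn_le_expn y : 0 < y ->
  exists2 C : R, 0 < C & forall M, (M%:R + 1) ^+ 2 <= C * (1 + y) ^+ M.
Proof.
move=> y0; have y1 : 1 < 1 + y by rewrite ltrDl.
have l0 := ln_gt0 y1; set l := ln (1 + y) in l0.
exists (4 / l ^+ 2 + 2) => [|M]; first by rewrite addr_gt0// divr_gt0 ?exprn_gt0.
have yE : expR (M%:R * l) = (1 + y) ^+ M.
  by rewrite expRM_natl lnK// posrE (lt_trans ltr01).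
have := @expR_ge1Dxn R (M%:R * l) 1%N (mulr_ge0 (ler0n _ M) (ltW l0)).
rewrite yE exprMn (_ : 2`!%:R = 2 :> R)//; set E := _ ^+ M; set m := M%:R => h.
have h' : m ^+ 2 * l ^+ 2 <= 2 * E.
  by move: h; set A := m ^+ 2 * l ^+ 2; lra.
have h2 : m ^+ 2 <= 2 * E / l ^+ 2 by rewrite ler_pdivlMr ?exprn_gt0.
have E1 : 1 <= E by apply: exprn_ege1; exact: ltW.
have : (m + 1) ^+ 2 <= 2 * m ^+ 2 + 2.
  by have := sqr_ge0 (m - 1); rewrite -subr_ge0 => h3; rewrite -subr_ge0; lra.
move/le_trans; apply; rewrite [leRHS]mulrDl.
have -> : 4 / l ^+ 2 * E = 2 * (2 * E / l ^+ 2) by field; rewrite lt0r_neq0.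
by lra.
Qed.

(** The functional f |-> f'(s) - (interpolant of f)'(s) annihilates polynomials
    of degree at most [M], so that in [f = expR (2 * t * _)] the Taylor
    polynomial at the midpoint [c] can be subtracted. *)
Lemma lagrange_exp_eq a b s t M : a < b -> (0 < M)%N ->
  let c := (a + b) / 2 in
  2 * t * expR (2 * t * s) -
    \sum_(m < M.+1) (lagrange_cheb a b m)^`().[s] *
                    expR (2 * t * cheb_node a b M m) =
  expR (2 * t * c) *
   (2 * t * (expR (2 * t * (s - c)) - exp_sum M (2 * t * (s - c))) -
    \sum_(m < M.+1) (lagrange_cheb a b m)^`().[s] *
       (expR (2 * t * (cheb_node a b M m - c)) -
        exp_sum M.+1 (2 * t * (cheb_node a b M m - c)))).
Proof.
move=> ab M0 c; set w := 2 * t.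
have eE y : expR (w * y) = expR (w * c) * expR (w * (y - c)).
  by rewrite -expRD -mulrDr addrC subrK.
have /(congr1 (fun p : {poly R} => p^`().[s])) :=
  lagrange_cheb_sum ab M0 (size_exp_taylor c w M.+1).
rewrite deriv_exp_taylor hornerZ exp_taylorE linear_sum horner_sum /= => PE.
have {}PE : \sum_(m < M.+1) (lagrange_cheb a b m)^`().[s] *
    exp_sum M.+1 (w * (cheb_node a b M m - c)) =
    w * exp_sum M (w * (s - c)).
  rewrite PE; apply: eq_bigr => m _.
  by rewrite derivZ hornerZ exp_taylorE mulrC.
under [in RHS]eq_bigr do rewrite mulrBr.
rewrite sumrB PE [w * (_ - _)]mulrBr opprB addrA subrK.
rewrite mulrBr mulrCA -eE; congr (_ - _).
by rewrite mulr_sumr; apply: eq_bigr => m _; rewrite mulrCA -eE.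
Qed.

(** With [L = b - a], [sg = L / eps] and [K = L + eps], the right-hand
    exponent is [(2 * b + eps) * t = 2 * t * c + K * t].  After factoring out
    [expR (2 * t * c)], the Taylor remainders have argument at most [L * |t|]
    in absolute value, and [expR_tail_le] with [q = K / L = 1 + 1 / sg] bounds
    them by [q ^- M * expR (K * |t|)], uniformly in [t].  As
    [q ^- M = sg ^ M / (1 + sg) ^ M], there remains a factor [(1 + sg) ^ M] to
    absorb the polynomial growth of the derivatives of the Lagrange
    polynomials.  Replacing [|t|] by [t] costs the constant
    [expR (2 * K * T)]. *)
Lemma interp_kernel_bound a b eps T : a < b -> 0 < eps -> 0 <= T ->
  exists2 C : R, 0 < C & forall M s t, (0 < M)%N -> a <= s <= b -> - T <= t ->
  `|2 * t * expR (2 * t * s) -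
    \sum_(m < M.+1) (lagrange_cheb a b m)^`().[s] *
                    expR (2 * t * cheb_node a b M m)| <=
  C * (((b - a) / eps) ^+ M * M%:R ^+ 2) * expR ((2 * b + eps) * t).
Proof.
move=> ab e0 T0; have L0 : 0 < b - a by rewrite subr_gt0.
set L := b - a in L0 *; set sg := L / eps.
have sg0 : 0 < sg by rewrite divr_gt0.
have [C0 C00 HC0] := sqrn_le_expn sg0.
set K := L + eps; set q := 1 + sg^-1; set th := (1 + sg)^-1.
have K0 : 0 < K by rewrite addr_gt0.
have th0 : 0 < th by rewrite invr_gt0 addr_gt0.
have qL : q * L = K.
  by rewrite /q /sg /K; field; rewrite !lt0r_neq0.
have th_le1 : th <= 1 by rewrite invf_le1 ?addr_gt0//; lra.
have th_sg : th <= sg^-1 by rewrite lef_pV2 ?posrE ?addr_gt0//; lra.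
exists ((2 / (th * L) + 4 / L * C0) * expR (2 * K * T)).
  have thL : 0 < th * L by rewrite mulr_gt0.
  rewrite mulr_gt0 ?expR_gt0// addr_gt0// ?divr_gt0//.
  by rewrite mulr_gt0// divr_gt0.
move=> M s t M0 sI tT.
rewrite lagrange_exp_eq//; set c := (a + b) / 2; set w := 2 * t.
have tail y N p : a <= y <= b -> 1 <= p ->
    `|expR (w * (y - c)) - exp_sum N (w * (y - c))| <=
    p ^- N * expR (p * L * `|t|).
  move=> /andP[ya yb] p1; apply: (le_trans (expR_tail_le _ _ p1)).
  have p0 : 0 <= p by apply: le_trans p1.
  rewrite ler_wpM2l ?invr_ge0 ?exprn_ge0// ler_expR -mulrA ler_wpM2l//.
  rewrite /w normrM normrM (ger0_norm (_ : 0 <= 2))// mulrAC ler_wpM2r//.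
  suff : `|y - c| <= L / 2 by lra.
  by rewrite ler_norml /c /L; apply/andP; split; lra.
have sgM0 : 0 <= sg ^+ M by rewrite exprn_ge0 ?ltW.
have M1 : 1 <= M%:R ^+ 2 :> R by rewrite exprn_ege1// ler1n.
set F := expR (K * `|t|); have F0 : 0 < F := expR_gt0 _.
(* The factor w is unbounded; it is absorbed by lowering q to q - th, which
   is still at least 1 / sg and at least 1. *)
have term1 : `|w * (expR (w * (s - c)) - exp_sum M (w * (s - c)))| <=
    2 / (th * L) * (sg ^+ M * M%:R ^+ 2) * F.
  have q1 : 1 <= q - th by rewrite /q; lra.
  have hw : `|w| <= 2 / (th * L) * expR (th * L * `|t|).
    have thL : 0 < th * L by rewrite mulr_gt0.
    rewrite mulrAC ler_pdivlMr// /w normrM (ger0_norm (_ : 0 <= 2))//.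
    suff : th * L * `|t| <= expR (th * L * `|t|) by lra.
    by rewrite (le_trans _ (expR_ge1Dx _))// lerDr.
  rewrite normrM (le_trans (ler_pM _ _ hw (tail s M _ sI q1)))//.
  have B : (q - th) ^- M <= sg ^+ M * M%:R ^+ 2.
    apply: (le_trans _ (ler_peMr sgM0 M1)).
    have q0 : 0 < q - th by apply: lt_le_trans q1.
    rewrite -exprVn lerXn2r ?nnegrE ?invr_ge0 ?(ltW q0) ?(ltW sg0)//.
    by rewrite -[leRHS]invrK lef_pV2 ?posrE ?invr_gt0// /q; lra.
  rewrite [leLHS](_ : _ = 2 / (th * L) * (q - th) ^- M * F).
    by rewrite ler_wpM2r ?(ltW F0)// ler_wpM2l// divr_ge0// mulr_ge0// ltW.
  have -> : F = expR (th * L * `|t|) * expR ((q - th) * L * `|t|).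
    by rewrite -expRD -mulrDl -mulrDl addrC subrK qL.
  ring.
have term2 : `|\sum_(m < M.+1) (lagrange_cheb a b m)^`().[s] *
       (expR (w * (cheb_node a b M m - c)) -
        exp_sum M.+1 (w * (cheb_node a b M m - c)))| <=
    4 / L * C0 * (sg ^+ M * M%:R ^+ 2) * F.
  have q1 : 1 <= q by rewrite /q lerDl invr_ge0 ltW.
  have q0 : 0 < q by apply: lt_le_trans q1.
  have qM : q ^- M = sg ^+ M / (1 + sg) ^+ M.
    have -> : q = (1 + sg) / sg by rewrite /q mulrDl mul1r divff ?lt0r_neq0// addrC.
    by rewrite -exprVn invf_div expr_div_n.
  apply: (@le_trans _ _ (\sum_(m < M.+1) (2 * M%:R ^+ 3 * (2 / L) * (q ^- M * F)))).
    apply: (le_trans (ler_norm_sum _ _ _)); apply: ler_sum => m _.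
    rewrite normrM ler_pM//; first by rewrite deriv_lagrange_cheb_le.
    apply: (le_trans (tail _ _ _ _ q1)).
      move: (cos_geN1 (m%:R * pi / M%:R : R)) (cos_le1 (m%:R * pi / M%:R : R)).
      rewrite /cheb_node; set y := cos _ => y1 y2.
      by apply/andP; split; rewrite /L in L0; nra.
    rewrite qL ler_wpM2r ?(ltW F0)// lef_pV2 ?posrE ?exprn_gt0//.
    by rewrite ler_weXn2l.
  rewrite sumr_const card_ord -[leLHS]mulr_natl qM.
  set E := (1 + sg) ^+ M; have E0 : 0 < E by rewrite exprn_gt0// addr_gt0.
  have h : M.+1%:R * M%:R / E <= C0 :> R.
    rewrite ler_pdivrMr// (le_trans _ (HC0 M))// expr2 -natr1 ler_wpM2l//.
    by rewrite lerDl.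
  rewrite [leLHS](_ : _ = 4 / L * (M.+1%:R * M%:R / E) * (sg ^+ M * M%:R ^+ 2) * F).
    rewrite ler_wpM2r ?(ltW F0)// ler_wpM2r ?mulr_ge0// ler_wpM2l//.
    by rewrite divr_ge0// ltW.
  by field; rewrite !lt0r_neq0.
rewrite normrM (ger0_norm (expR_ge0 _)).
(* Since - T <= t and 0 <= T, one has |t| <= t + 2 * T. *)
have hE : expR (w * c) * F <= expR (2 * K * T) * expR ((2 * b + eps) * t).
  rewrite -!expRD ler_expR /w /c /K.
  have /(ler_wpM2l (ltW K0)) : `|t| <= t + 2 * T.
    by rewrite ler_norml; apply/andP; split; lra.
  by rewrite /K /L; lra.
set X := sg ^+ M * M%:R ^+ 2; have X0 : 0 <= X by rewrite mulr_ge0.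
set D := 2 / (th * L) + 4 / L * C0.
have D0 : 0 <= D.
  rewrite addr_ge0 ?mulr_ge0 ?divr_ge0 ?invr_ge0 ?(ltW C00) ?(ltW L0)//.
  by rewrite mulr_ge0 ?(ltW th0) ?(ltW L0).
apply: (@le_trans _ _ (expR (w * c) * (D * X * F))).
  rewrite ler_wpM2l ?expR_ge0// (le_trans (ler_normB _ _))//.
  by rewrite (le_trans (lerD term1 term2))// /D -!mulrDl.
rewrite [leLHS](_ : _ = D * X * (expR (w * c) * F)); last by ring.
rewrite [leRHS](_ : _ = D * X * (expR (2 * K * T) * expR ((2 * b + eps) * t))).
  by rewrite ler_wpM2l// mulr_ge0.
by ring.
Qed.

End kernel.

(** * Cauchy-Schwarz and linearity of the integral *)

Section cauchy_schwarz.
Context d (T : measurableType d) (R : realType)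
  (mu : {measure set T -> \bar R}).
Implicit Types (D : set T) (f g h : T -> R).

Lemma Lnorm2E f : (\int[mu]_x (f x ^+ 2)%:E < +oo)%E ->
  Lnorm mu 2%:E (EFin \o f) =
  (Num.sqrt (fine (\int[mu]_x (f x ^+ 2)%:E)%E))%:E.
Proof.
move=> foo; rewrite unlock.
have -> : (\int[mu]_x (`|(EFin \o f) x| `^ 2))%E = (\int[mu]_x (f x ^+ 2)%:E)%E.
  apply: eq_integral => x _.
  by rewrite [(`|_|)%E]/= poweR_EFin powR_mulrn// real_normK// num_real.
have f0 : (0 <= \int[mu]_x (f x ^+ 2)%:E)%E.
  by apply: integral_ge0 => x _; rewrite lee_fin sqr_ge0.
rewrite -[X in (X `^ _)%E]fineK ?ge0_fin_numE// poweR_EFin powR12_sqrt//.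
exact: fine_ge0.
Qed.

(** Cauchy-Schwarz.  Stating it for a function dominated by [f * g] gives the
    integrability of a form and the bound on its value at once. *)
Lemma dominated_Rintegral_le D f g h (C : R) : measurable D ->
  measurable_fun [set: T] f -> measurable_fun [set: T] g ->
  measurable_fun [set: T] h ->
  (\int[mu]_x (f x ^+ 2)%:E < +oo)%E -> (\int[mu]_x (g x ^+ 2)%:E < +oo)%E ->
  0 <= C -> (forall x, D x -> `|h x| <= C * `|f x * g x|) ->
  mu.-integrable D (EFin \o h) /\
  `|\int[mu]_(x in D) h x| <=
    C * Num.sqrt (fine (\int[mu]_x (f x ^+ 2)%:E)%E) *
        Num.sqrt (fine (\int[mu]_x (g x ^+ 2)%:E)%E).
Proof.
move=> mD mf mg mh foo goo C0 hfg.
have mfg : measurable_fun [set: T] (fun x => `|f x * g x|).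
  by apply: measurableT_comp => //; exact: measurable_funM.
have := @hoelder _ _ _ mu f g 2 2 mf mg ltac:(by []) ltac:(by []).
rewrite Lnorm1 !Lnorm2E// => hol.
have bound : (\int[mu]_(x in D) `|(h x)%:E| <=
    (C * Num.sqrt (fine (\int[mu]_x (f x ^+ 2)%:E)) *
        Num.sqrt (fine (\int[mu]_x (g x ^+ 2)%:E)))%:E)%E.
  apply: (@le_trans _ _ (\int[mu]_(x in D) (C%:E * `|f x * g x|%:E))%E).
    apply: ge0_le_integral => //.
    - by apply/measurable_EFinP; apply: measurableT_comp => //; exact: measurable_funTS.
    - by apply/measurable_EFinP/measurable_funM => //; exact: measurable_funTS.
  rewrite ge0_integralZl//; last exact/measurable_EFinP/measurable_funTS.
  rewrite -mulrA EFinM lee_wpmul2l ?lee_fin//.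
  apply: (@le_trans _ _ (\int[mu]_x `|f x * g x|%:E)%E).
    apply: ge0_subset_integral => //; first exact/measurable_EFinP.
  rewrite EFinM; apply: hol.
  by field.
have ih : mu.-integrable D (EFin \o h).
  apply/integrableP; split; first exact/measurable_EFinP/measurable_funTS.
  by apply: le_lt_trans bound _; rewrite ltry.
split=> //; rewrite (le_trans (le_normr_Rintegral mD ih))//.
rewrite -lee_fin /Rintegral fineK//.
by apply: integrable_fin_num => //; exact: integrable_norm.
Qed.

Lemma Rintegral_sum (I : Type) (r : seq I) D (F : I -> T -> R) :
  measurable D -> (forall i, mu.-integrable D (EFin \o F i)) ->
  mu.-integrable D (EFin \o (fun x => \sum_(i <- r) F i x)) /\
  \int[mu]_(x in D) (\sum_(i <- r) F i x) =
  \sum_(i <- r) \int[mu]_(x in D) F i x.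
Proof.
move=> mD iF; have iS s :
    mu.-integrable D (EFin \o (fun x => \sum_(i <- s) F i x)).
  rewrite (_ : _ \o _ = fun x => (\sum_(i <- s) (F i x)%:E)%E).
    by apply: integrable_sum => // i _; exact: iF.
  by apply/funext => x; rewrite /= sumEFin.
split=> //; elim: r => [|i r IH].
  rewrite big_nil; under eq_Rintegral do rewrite big_nil.
  by rewrite Rintegral_cst// mul0r.
rewrite big_cons -IH -RintegralD//.
by apply: eq_Rintegral => x _; rewrite big_cons.
Qed.

End cauchy_schwarz.

(** * Nonlocal forms and Gagliardo seminorms *)

Section gagliardo.
Context {R : realType} {n : nat}.
Implicit Types (u v : 'rV[R]_n -> R) (s t r delta K : R) (k : R -> R).
Implicit Types (z : 'rV[R]_n * 'rV[R]_n).

Local Notation mu := (lebesgue_rV R n).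
Local Notation mu2 := (mu \x mu)%E.
Local Notation dist z := (enorm (z.1 - z.2)).

Lemma enorm_ge0 (x : 'rV[R]_n) : 0 <= enorm x.
Proof. exact: sqrtr_ge0. Qed.

Lemma enorm_eq0 (x : 'rV[R]_n) : enorm x = 0 -> x = 0.
Proof.
move=> /eqP; rewrite sqrtr_eq0 => x0.
have /eqP : \sum_i x 0 i ^+ 2 = 0.
  by apply/eqP; rewrite eq_le x0 sumr_ge0// => i _; rewrite sqr_ge0.
rewrite psumr_eq0 => [/allP h|i _]; last exact: sqr_ge0.
apply/rowP => i; rewrite mxE; apply/eqP.
by have := h i (mem_index_enum _); rewrite /= sqrf_eq0.
Qed.

Lemma measurable_dist :
  measurable_fun [set: 'rV[R]_n * 'rV[R]_n] (fun z => dist z : R).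
Proof.
apply: (measurableT_comp (f := @Num.sqrt R)).
  by apply: continuous_measurable_fun; exact: sqrt_continuous.
apply: measurable_sum => i; apply: measurable_funX.
rewrite (_ : (fun z => _) =
    (fun z : 'rV[R]_n * 'rV[R]_n => z.1 0 i - z.2 0 i)); last first.
  by apply/funext => z; rewrite !mxE.
apply: measurable_funB.
- exact: measurableT_comp (measurable_coord i) measurable_fst.
- exact: measurableT_comp (measurable_coord i) measurable_snd.
Qed.

Lemma measurable_near_diag delta : measurable (near_diag (n := n) delta).
Proof.
rewrite [near_diag delta](_ : _ = setT `&` (fun z => dist z) @^-1` `]-oo, delta]).
  exact: measurable_dist.
by apply/seteqP; split => z /=; rewrite in_itv /= => // -[].
Qed.

Lemma measurable_diff u : measurable_fun [set: 'rV[R]_n] u ->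
  measurable_fun [set: 'rV[R]_n * 'rV[R]_n] (fun z => u z.1 - u z.2).
Proof.
move=> um; apply: measurable_funB.
- exact: measurableT_comp um measurable_fst.
- exact: measurableT_comp um measurable_snd.
Qed.

(** A square root of the integrand of the Gagliardo seminorm. *)
Definition gagliardo_root t u z : R :=
  (u z.1 - u z.2) * dist z `^ (- ((n%:R + 2 * t) / 2)).

Lemma measurable_gagliardo_root t u : measurable_fun [set: 'rV[R]_n] u ->
  measurable_fun [set: 'rV[R]_n * 'rV[R]_n] (gagliardo_root t u).
Proof.
move=> um; apply: measurable_funM; first exact: measurable_diff.
exact: measurableT_comp (measurable_powR _) measurable_dist.
Qed.

Lemma gagliardo2E t u :
  gagliardo2 t u = (\int[mu2]_z (gagliardo_root t u z ^+ 2)%:E)%E.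
Proof.
apply: eq_integral => z _; congr EFin.
by rewrite exprMn -[X in _ = _ * X]powR_mulrn ?powR_ge0// -powRrM mulNr divfK// powRN.
Qed.

Lemma gagliardo_rootM t s u v z : 0 < t -> 0 < s ->
  gagliardo_root t u z * gagliardo_root s v z =
  (u z.1 - u z.2) * (v z.1 - v z.2) * dist z `^ (- (n%:R + t + s)).
Proof.
move=> t0 s0; rewrite /gagliardo_root mulrACA; congr (_ * _).
have n0 : (0 : R) <= n%:R by [].
rewrite -powRD; first by congr powR; field.
by apply/implyP => /eqP h; exfalso; lra.
Qed.

(** The kernel is compared with [r ^ (- (n + s2 + s1))], for which the form is
    the scalar product of the two Gagliardo square roots.  On the diagonal the
    kernel is unconstrained but the increments vanish. *)
Lemma Rintegral_kernel_le (s1 s2 : R) delta K k u v :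
  0 < s1 -> 0 < s2 -> Hspace s2 u -> Hspace s1 v ->
  measurable_fun [set: R] k -> 0 <= K ->
  (forall r, 0 < r -> r <= delta ->
    `|k r| <= K * r `^ (- (n%:R + s2 + s1))) ->
  mu2.-integrable (near_diag delta)
    (EFin \o (fun z => (u z.1 - u z.2) * (v z.1 - v z.2) * k (dist z))) /\
  `|\int[mu2]_(z in near_diag delta)
      ((u z.1 - u z.2) * (v z.1 - v z.2) * k (dist z))| <=
  K * Hsemi s2 u * Hsemi s1 v.
Proof.
move=> s10 s20 [um _ uoo] [mv _ voo] mk K0 hk.
move: uoo voo; rewrite /Hsemi !gagliardo2E => uoo voo.
apply: (dominated_Rintegral_le (f := gagliardo_root s2 u)
  (g := gagliardo_root s1 v)) => //.
- exact: measurable_near_diag.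
- exact: measurable_gagliardo_root.
- exact: measurable_gagliardo_root.
- apply: measurable_funM; last exact: measurableT_comp mk measurable_dist.
  by apply: measurable_funM; exact: measurable_diff.
move=> z zd; rewrite gagliardo_rootM// !normrM [leRHS]mulrCA.
have [z0|z0] := eqVneq (dist z) 0.
  have /eqP := enorm_eq0 z0; rewrite subr_eq0 => /eqP ->.
  by rewrite subrr normr0 !mul0r.
have z1 : 0 < dist z by rewrite lt_neqAle eq_sym z0 enorm_ge0.
rewrite ler_wpM2l// (le_trans (hk _ z1 zd))//.
by rewrite ler_wpM2l// ler_norm.
Qed.

(** The difference of the two forms is the form of the difference of the
    kernels.  Linearity requires each kernel to be integrable: for
    [y <= b < (s1 + s2) / 2] the functions [r ^ (s1 + s2 - 2 * y)] and
    [ln r * r ^ (s1 + s2 - 2 * y)] are bounded on [0 < r <= delta]. *)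
Lemma daform_interp_Rintegral (s1 s2 a b delta s : R) (M : nat) u v :
  0 < s1 -> 0 < s2 -> 0 < delta -> a < b -> 2 * b < s1 + s2 ->
  Hspace s2 u -> Hspace s1 v -> a <= s <= b ->
  daform u v s delta - daform_interp u v a b M s delta =
  \int[mu2]_(z in near_diag delta)
    ((u z.1 - u z.2) * (v z.1 - v z.2) *
     (- 2 * ln (dist z) / dist z `^ (n%:R + 2 * s) -
      \sum_(m < M.+1) (lagrange_cheb a b m)^`().[s] /
         dist z `^ (n%:R + 2 * cheb_node a b M m))).
Proof.
move=> s10 s20 d0 ab bs Hu Hv /andP[sa sb].
set T := `|ln delta|; have T0 : 0 <= T by exact: normr_ge0.
have tT r : 0 < r -> r <= delta -> - ln r >= - T.
  move=> r0 rd; rewrite lerN2 (le_trans _ (ler_norm _))//.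
  by rewrite ler_ln ?posrE.
have mD := @measurable_near_diag delta.
have powE r p : 0 < r -> r `^ p = expR (p * ln r).
  by move=> r0; rewrite /powR gt_eqF.
have iA y : y <= b -> mu2.-integrable (near_diag delta) (EFin \o (fun z =>
    (u z.1 - u z.2) * (v z.1 - v z.2) / dist z `^ (n%:R + 2 * y))).
  move=> yb; pose k r : R := (r `^ (n%:R + 2 * y))^-1.
  have mk : measurable_fun [set: R] k.
    rewrite (_ : k = fun r => r `^ (- (n%:R + 2 * y))); last first.
      by apply/funext => r; rewrite powRN.
    exact: measurable_powR.
  have [] // := @Rintegral_kernel_le s1 s2 delta (expR ((s1 + s2 - 2 * y) * T)) k
    u v s10 s20 Hu Hv mk (expR_ge0 _).
  move=> r r0 rd; rewrite /k -powRN ger0_norm ?powR_ge0// !powE// -expRD ler_expR.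
  have := tT _ r0 rd; nra.
have iB : mu2.-integrable (near_diag delta) (EFin \o (fun z =>
    (u z.1 - u z.2) * (v z.1 - v z.2) * ln (dist z) /
      dist z `^ (n%:R + 2 * s))).
  pose k r : R := ln r / r `^ (n%:R + 2 * s).
  have mk : measurable_fun [set: R] k.
    apply: measurable_funM; first exact: measurable_ln.
    rewrite (_ : (fun _ => _) = fun r => r `^ (- (n%:R + 2 * s))); last first.
      by apply/funext => r; rewrite powRN.
    exact: measurable_powR.
  set e := s1 + s2 - 2 * s; have e0 : 0 < e by rewrite /e; lra.
  have K0 : 0 <= e^-1 * expR (2 * e * T).
    by rewrite mulr_ge0 ?expR_ge0// invr_ge0 ltW.
  have [] := @Rintegral_kernel_le s1 s2 delta _ k u v s10 s20 Hu Hv mk K0; last first.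
    move=> + _; congr (_.-integrable _ (_ \o _)).
    by apply/funext => z; rewrite /k mulrA.
  move=> r r0 rd; rewrite /k -powRN normrM [X in _ * X]ger0_norm ?powR_ge0//.
  rewrite !powE//.
  have h : `|ln r| <= e^-1 * expR (e * `|ln r|).
    rewrite mulrC ler_pdivlMr// mulrC (le_trans _ (expR_ge1Dx _))//.
    by rewrite lerDr.
  apply: (le_trans (ler_wpM2r (expR_ge0 _) h)).
  rewrite -!mulrA ler_wpM2l ?invr_ge0 ?(ltW e0)// -!expRD ler_expR.
  have : `|ln r| <= - ln r + 2 * T.
    by have := tT _ r0 rd; rewrite ler_norml => ?; apply/andP; split; lra.
  move=> /(ler_wpM2l (ltW e0)); rewrite /e; lra.
have node_le m : cheb_node a b M m <= b.
  have := cos_le1 (m%:R * pi / M%:R : R); rewrite /cheb_node.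
  by set y := cos _ => y1; nra.
pose A m z := (u z.1 - u z.2) * (v z.1 - v z.2) /
  dist z `^ (n%:R + 2 * cheb_node a b M m).
pose B z := (u z.1 - u z.2) * (v z.1 - v z.2) * ln (dist z) /
  dist z `^ (n%:R + 2 * s).
have iL (m : 'I_M.+1) : mu2.-integrable (near_diag delta)
    (EFin \o (fun z => (lagrange_cheb a b m)^`().[s] * A m z)).
  exact: integrableZl (iA _ (node_le m)).
have [iS ES] := Rintegral_sum (index_enum 'I_M.+1) mD iL.
have iB2 : mu2.-integrable (near_diag delta) (EFin \o (fun z => - 2 * B z)).
  exact: integrableZl iB.
transitivity (\int[mu2]_(z in near_diag delta) (- 2 * B z -
    \sum_(m < M.+1) (lagrange_cheb a b m)^`().[s] * A m z)).
  rewrite RintegralB// RintegralZl// ES; congr (_ - _).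
  by apply: eq_bigr => m _; rewrite RintegralZl//; exact: iA.
apply: eq_Rintegral => z _; rewrite mulrBr /B; congr (_ - _); first by ring.
by rewrite mulr_sumr; apply: eq_bigr => m _; rewrite /A mulrCA mulrA.
Qed.

End gagliardo.

(** * The error of the interpolated derivative *)

Theorem lemma5p4 (R : realType) (n : nat) (n_ge1 : (1 <= n)%N)
    (Omega : set 'rV[R]_n) (Omega_dom : smooth_bounded_domain Omega)
    (smin smax s1 s2 delta : R)
    (smin_gt0 : 0 < smin) (smin_smax : smin < smax) (smax_lt1 : smax < 1)
    (s1_itv : 0 < s1 < 1) (s2_itv : 0 < s2 < 1)
    (smax_itv : (s1 + s2) / 2 - 1 / 2 < smax < (s1 + s2) / 2)
    (delta_gt0 : 0 < delta) :
  exists C : R, 0 < C /\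
    forall (u v : 'rV[R]_n -> R) (s : R) (M : nat),
      HspaceOmega Omega s2 u -> HspaceOmega Omega s1 v ->
      smin <= s <= smax -> (2 < M)%N ->
      `| daform u v s delta - daform_interp u v smin smax M s delta | <=
        C * eta_tilde s1 s2 smin smax M * Hsemi s2 u * Hsemi s1 v.
Proof.
have [[s10 _] [s20 _]] := (andP s1_itv, andP s2_itv).
have [_ bs] := andP smax_itv.
have e0 : 0 < eps_hat s1 s2 smax by rewrite /eps_hat; lra.
have [C C0 HC] := interp_kernel_bound smin_smax e0 (normr_ge0 (ln delta)).
exists C; split=> // u v s M [Hu _] [Hv _] sI M2.
have M0 : (0 < M)%N by case: M M2.
rewrite (daform_interp_Rintegral M (s1 := s1) (s2 := s2))//; last by lra.
pose k r : R := - 2 * ln r / r `^ (n%:R + 2 * s) -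
      \sum_(m < M.+1) (lagrange_cheb smin smax m)^`().[s] /
         r `^ (n%:R + 2 * cheb_node smin smax M m).
have mpow p : measurable_fun [set: R] (fun r : R => (r `^ p)^-1).
  rewrite (_ : (fun _ => _) = fun r => r `^ (- p)); first exact: measurable_powR.
  by apply/funext => r; rewrite powRN.
have mk : measurable_fun [set: R] k.
  apply: measurable_funB.
    by apply: measurable_funM => //; apply: measurable_funM => //; exact: measurable_ln.
  by apply: measurable_sum => m; exact: measurable_funM.
apply: (Rintegral_kernel_le s10 s20 Hu Hv mk _ _).2 => [|r r0 rd].
  rewrite mulr_ge0 ?(ltW C0)// /eta_tilde mulr_ge0 ?exprn_ge0//.
  by rewrite divr_ge0 ?(ltW e0)// subr_ge0 ltW.
have powE p : r `^ p = expR (p * ln r) by rewrite /powR gt_eqF.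
have tT : - `|ln delta| <= - ln r.
  by rewrite lerN2 (le_trans _ (ler_norm _))// ler_ln ?posrE.
have := HC M s (- ln r) M0 sI tT; set t := - ln r => h.
have lE : ln r = - t by rewrite opprK.
have powVE y : (r `^ (n%:R + 2 * y))^-1 = expR (n%:R * t) * expR (2 * t * y).
  by rewrite -powRN powE lE -expRD; congr expR; ring.
have -> : k r = expR (n%:R * t) * (2 * t * expR (2 * t * s) -
    \sum_(m < M.+1) (lagrange_cheb smin smax m)^`().[s] *
       expR (2 * t * cheb_node smin smax M m)).
  rewrite /k powVE lE mulrBr mulr_sumr; congr (_ - _); first by ring.
  by apply: eq_bigr => m _; rewrite powVE mulrCA.
rewrite normrM (ger0_norm (expR_ge0 _)).
apply: (le_trans (ler_wpM2l (expR_ge0 _) h)).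
rewrite mulrCA /eta_tilde /sigma_tilde ler_wpM2l//.
  rewrite mulr_ge0 ?(ltW C0)// mulr_ge0 ?exprn_ge0//.
  by rewrite divr_ge0 ?(ltW e0)// subr_ge0 ltW.
rewrite powE lE -expRD ler_expR /eps_hat; lra.
Qed.
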